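(* Let $n,m,k$ be integers with $m\geq 1$, $k\geq 3$ and $n\geq 6m+7$. Then $$ gr_{k}(K_{3} : S(n,m))=\begin{cases} 5\cdot\frac{n}{2} + m(k-3)+1 & \text{ if $n$ is even,}\\ 5\cdot\frac{n-1}{2} + m(k-3)+ 2 & \text{ if $n$ is odd.} \end{cases} $$
   Context: For integers $n\geq m\geq 0$, the double star $S(n,m)$ is the graph obtained from the disjoint union of the stars $K_{1,n}$ and $K_{1,m}$ by adding an edge between their centers. A $k$-coloring of a graph is an assignment of one of $k$ colors to each edge. A subgraph is rainbow if all its edges have distinct colors and monochromatic if all its edges have the same color. For graphs $G,H$ and a positive integer $k$, the Gallai–Ramsey number $gr_k(G:H)$ is the minimum integer $N$ such that every $k$-coloring of the edges of the complete graph $K_N$ contains either a rainbow copy of $G$ or a monochromatic copy of $H$. *)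

(* Defs.v *)
From mathcomp Require Import all_boot.
Set Implicit Arguments. Unset Strict Implicit. Unset Printing Implicit Defensive.

(* An edge k-coloring of K_N on vertex set 'I_N: a symmetric function
   giving each unordered pair {x,y} (x <> y) a color in 'I_k.
   (Values on the diagonal are irrelevant.) *)
Definition edge_coloring (N k : nat) (c : 'I_N -> 'I_N -> 'I_k) : Prop :=
  forall x y : 'I_N, c x y = c y x.

Definition has_rainbow_K3 (N k : nat) (c : 'I_N -> 'I_N -> 'I_k) : Prop :=
  exists x y z : 'I_N,
    [/\ x != y, y != z, x != z &
      [/\ c x y != c y z, c y z != c x z & c x y != c x z]].

(* c contains a monochromatic (not necessarily induced) copy of the double
   star S(n,m): centers u,v, leaf sets A (|A| = n) adjacent to u and
   B (|B| = m) adjacent to v, all n+m+2 vertices distinct, every edge of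
   the copy of color col. *)
Definition has_mono_double_star (N k : nat) (c : 'I_N -> 'I_N -> 'I_k)
    (n m : nat) : Prop :=
  exists (col : 'I_k) (u v : 'I_N) (A B : {set 'I_N}),
    [/\ u != v, #|A| = n, #|B| = m,
        [/\ u \notin A, v \notin A, u \notin B, v \notin B
          & [disjoint A & B]] &
        [/\ c u v = col,
            (forall a, a \in A -> c u a = col)
          & (forall b, b \in B -> c v b = col)]].

Definition GR_prop (k n m N : nat) : Prop :=
  forall c : 'I_N -> 'I_N -> 'I_k,
    edge_coloring c -> has_rainbow_K3 c \/ has_mono_double_star c n m.

Definition is_gr_K3_double_star (k n m g : nat) : Prop :=
  GR_prop k n m g /\ forall N, N < g -> ~ GR_prop k n m N.

(* Main.v *)
Require Import Defs.
From mathcomp Require Import all_boot.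
From mathcomp Require Import zify.
Set Implicit Arguments. Unset Strict Implicit. Unset Printing Implicit Defensive.

(* Lower bound: blow up the 2-coloured pentagon on five classes of size about
   n/2, coloured with a third colour inside, and add, for each further colour,
   m vertices joined in that colour to everything before them.

   Upper bound: call A homogeneous if every vertex outside A sends a single
   colour to A, and take A minimal among the homogeneous sets with more than n
   vertices.  A colour occurring between A and its complement reaches at most m
   vertices outside A, and then has degree at most m at every vertex of A.
   Gallai's theorem splits A into homogeneous parts with two colours r, b
   between them, and by minimality all parts have size at most n.  If r or b
   also leaves A, the other one is too dense.  If all colours but r and b leave
   A, then r and b have total degree more than 2(n + m) at each vertex of A,
   whereas neither can exceed n + m.  Otherwise |A| is at least the value claimed
   for k = 3; a part larger than n/2 is refuted by counting the edges between
   its r-neighbours and its b-neighbours, and if all parts have size at most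
   n/2 then some vertex u has more than n neighbours of one colour, say r; any
   r-neighbour v of u has few r-neighbours that are not r-neighbours of u, hence
   too many b-neighbours. *)

(** * The extremal colouring *)

Definition nbr (T : finType) (K : eqType) (c : T -> T -> K) (i : K) (x : T) :=
  [set y | (y != x) && (c x y == i)].

Lemma double_star_nbr (N k n m : nat) (c : 'I_N -> 'I_N -> 'I_k) :
  edge_coloring c -> has_mono_double_star c n m ->
  exists i u v, [/\ v \in nbr c i u, u \in nbr c i v,
                    n < #|nbr c i u| & m < #|nbr c i v|].
Proof.
move=> csym [i [u [v [A [B [uv cA cB [uA vA uB vB _] [cuv cuA cvB]]]]]]].
have cvu : c v u = i by rewrite csym.
exists i, u, v; rewrite !inE cuv cvu eqxx (eq_sym v) uv; split=> //.
- have: v |: A \subset nbr c i u.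
    apply/subsetP=> x; rewrite !inE => /orP[/eqP->|xA].
      by rewrite eq_sym uv cuv eqxx.
    by rewrite cuA // eqxx andbT; apply: contraNneq uA => <-.
  by move/subset_leq_card; rewrite cardsU1 vA cA.
- have: u |: B \subset nbr c i v.
    apply/subsetP=> x; rewrite !inE => /orP[/eqP->|xB].
      by rewrite uv cvu eqxx.
    by rewrite cvB // eqxx andbT; apply: contraNneq vB => <-.
  by move/subset_leq_card; rewrite cardsU1 uB cB.
Qed.

Lemma card_le_inj_nat (T : finType) (A : {set T}) (f : T -> nat) (b : nat) :
  {in A &, injective f} -> (forall x, x \in A -> f x < b) -> #|A| <= b.
Proof.
case: b => [|b] fI fb.
  by rewrite leqn0 cards_eq0; apply/eqP/setP=> x; rewrite inE; apply/negP=> /fb.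
rewrite -[b.+1]card_ord.
apply: (@leq_card_in _ _ (fun x => inord (f x) : 'I_b.+1)) => x y xA yA /(congr1 val).
by rewrite /= !inordK ?fb //; apply: fI.
Qed.

Section Extremal.
Variables n m : nat.

(* The core [0, core_size) has five classes, the residues mod 5, any two of
   which have at most n vertices together; it is followed by levels of m
   vertices each, with one new colour per level. *)
Definition core_size := 5 * (n %/ 2) + odd n.
Definition level (x : nat) := if x < core_size then 0 else ((x - core_size) %/ m).+1.
(* Colours 0 and 1 are the two 5-cycles on the residues. *)
Definition core_color (x y : nat) : nat :=
  let d := (x %% 5 + 5 - y %% 5) %% 5 in
  if d == 0 then 2 else if (d == 1) || (d == 4) then 0 else 1.
(** Between two levels the higher one fixes the colour, from 3 upwards. Inside a new level colour 0
    is reused, which is harmless on only [m] vertices. *)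
Definition extremal (x y : nat) : nat :=
  if level x == level y then (if level x == 0 then core_color x y else 0)
  else 2 + maxn (level x) (level y).

Lemma core_colorC x y : core_color x y = core_color y x.
Proof.
rewrite /core_color; have := ltn_pmod x (isT : 0 < 5); have := ltn_pmod y (isT : 0 < 5).
by case: (x %% 5) => [|[|[|[|[|?]]]]] //; case: (y %% 5) => [|[|[|[|[|?]]]]].
Qed.

Lemma core_color_nbr x : forall i, exists a b, a < b < 5 /\
  forall y, core_color x y = i -> (y %% 5 == a) || (y %% 5 == b).
Proof.
move=> i.
have mod5 y : core_color x y = core_color (x %% 5) (y %% 5).
  by rewrite /core_color !modn_mod.
have lt5 y : y %% 5 < 5 by rewrite ltn_pmod.
case: (ltnP i 3) => [i3|i3]; last first.
  exists 0, 1; split=> // y; rewrite /core_color.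
  by do !case: ifP => _; move=> yi; rewrite -yi in i3.
suff: has (fun p => (p.1 < p.2) && all (fun z => (core_color (x %% 5) z == i)
         ==> (z == p.1) || (z == p.2)) (iota 0 5))
       [seq (a, b) | a <- iota 0 5, b <- iota 0 5].
  case/hasP=> p /allpairsP[[a b] [_ b5 ->]] /andP[ab /allP h].
  exists a, b; split; first by move: b5; rewrite mem_iota ab.
  move=> y /eqP; rewrite mod5 => yi.
  by have := h (y %% 5); rewrite yi mem_iota lt5; apply.
have := lt5 x; case: (x %% 5) => [|[|[|[|[|?]]]]] // _;
  by case: i i3 => [|[|[|?]]].
Qed.

Lemma card_core_nbr N (x : 'I_N) i :
  #|[set y : 'I_N | (y < core_size) && (core_color x y == i)]| <= n.
Proof.
have [a [b [/andP[ab b5] h]]] := core_color_nbr x i.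
(* The two residue classes are numbered alternately. For odd [n] the extra vertex has residue 0,
   which is not [b] since [a < b], so its number is at most [n - 1]. *)
apply: (@card_le_inj_nat _ _ (fun y : 'I_N => 2 * (y %/ 5) + (y %% 5 == b))).
  move=> y z; rewrite !inE => /andP[_ /eqP/h hy] /andP[_ /eqP/h hz] e.
  by apply: val_inj => /=; lia.
by move=> y; rewrite !inE /core_size => /andP[yP /eqP/h]; lia.
Qed.

Lemma card_level N l : 0 < m -> 0 < l -> #|[set y : 'I_N | level y == l]| <= m.
Proof.
move=> m0 l0; apply: (@card_le_inj_nat _ _ (fun y : 'I_N => (y - core_size) %% m)).
  move=> y z; rewrite !inE /level; case: ifP => [_ /eqP|]; first by lia.
  move=> yP /eqP yl; case: ifP => [_ /eqP|]; first by lia.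
  move=> zP /eqP zl e; apply: val_inj => /=.
  have := divn_eq (y - core_size) m; have := divn_eq (z - core_size) m.
  by rewrite e; have -> : (y - core_size) %/ m = (z - core_size) %/ m; lia.
by move=> y _; rewrite ltn_pmod.
Qed.

Lemma core_color_lt3 x y : core_color x y < 3.
Proof. by rewrite /core_color; do !case: ifP => _. Qed.

(** Of three vertices not on one level, two edges join the highest level to a lower one and agree.
    In the core, edges between distinct classes have two colours only, and two vertices of one class
    send the same colour to a third vertex. *)
Lemma extremal_no_rainbow x y z :
  ~ [/\ extremal x y != extremal y z, extremal y z != extremal x z
      & extremal x y != extremal x z].
Proof.
rewrite /extremal.
have [->|xy] := eqVneq (level x) (level y); last first.
  move: xy; have [->|yz] := eqVneq (level y) (level z) => xy.
    by rewrite (negPf xy) eqxx => -[].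
  by have [xz|xz] := eqVneq (level x) (level z); case; lia.
have [->|yz] := eqVneq (level y) (level z); last by move=> []; lia.
case: ifP => _; last by rewrite eqxx => -[].
rewrite /core_color.
have := ltn_pmod x (isT : 0 < 5); have := ltn_pmod y (isT : 0 < 5).
have := ltn_pmod z (isT : 0 < 5).
case: (x %% 5) => [|[|[|[|[|?]]]]] //; case: (y %% 5) => [|[|[|[|[|?]]]]] //;
by case: (z %% 5) => [|[|[|[|[|?]]]]] // _ _ _ [].
Qed.

(** At the lower end of an edge between levels, its colour reaches only the upper level, so at most
    [m] vertices. The colour of an edge inside a level has degree at most [n] at both ends. *)
Lemma extremal_no_star N (u v : 'I_N) i : 0 < m <= n -> v != u -> extremal u v = i ->
  n < #|[set y : 'I_N | (y != u) && (extremal u y == i)]| ->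
  m < #|[set y : 'I_N | (y != v) && (extremal v y == i)]| -> False.
Proof.
move=> /andP[m0 mn] uv uvi.
have lvl w l : 0 < l -> (forall y : 'I_N, y != w -> extremal w y = i -> level y = l) ->
    m < #|[set y : 'I_N | (y != w) && (extremal w y == i)]| -> False.
  move=> l0 h; rewrite ltnNge => /negP; apply; apply: leq_trans (card_level N m0 l0).
  apply: subset_leq_card; apply/subsetP=> y; rewrite !inE => /andP[yw /eqP yi].
  by apply/eqP/h.
have [luv|luv] := eqVneq (level u) (level v).
  have [lu|lu] := posnP (level u); last first.
    move=> /(leq_ltn_trans mn) + _; apply: (lvl u (level u)) => // y yu.
    by rewrite -uvi /extremal luv eqxx -luv [level u == 0]gtn_eqF //; case: eqP => // _; lia.
  move=> + _; rewrite ltnNge => /negP; apply; apply: leq_trans (card_core_nbr u i).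
  apply: subset_leq_card; apply/subsetP=> y; rewrite !inE => /andP[yu /eqP].
  rewrite -uvi /extremal -luv lu /=; case: eqP => [ly -> | ly]; last first.
    by have := core_color_lt3 u v; lia.
  by rewrite eqxx andbT; move: ly; rewrite /level; case: ifP.
have := uvi; rewrite {1}/extremal (negPf luv) => il.
case: (ltnP (level u) (level v)) => luv'.
  move=> /(leq_ltn_trans mn) + _; apply: (lvl u (level v)) => [|y yu]; first by lia.
  rewrite /extremal -il; case: eqP => [ly|]; last by lia.
  case: ifP => _; last by lia.
  by have := core_color_lt3 u y; lia.
move=> _; apply: (lvl v (level u)) => [|y yu]; first by lia.
rewrite /extremal -il; case: eqP => [ly|]; last by lia.
case: ifP => _; last by lia.
by have := core_color_lt3 v y; lia.
Qed.

End Extremal.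

Lemma GR_prop_lower (n m k N : nat) : 0 < m <= n -> 2 < k ->
  N <= core_size n + m * (k - 3) -> ~ GR_prop k n m N.
Proof.
move=> mn k3 Nle.
have col_lt (x y : 'I_N) : extremal n m x y < k.
  have lev (z : 'I_N) : level n m z <= k - 3.
    rewrite /level; case: ifP => // zP; rewrite ltn_divLR; last by lia.
    by have := ltn_ord z; lia.
  rewrite /extremal; have := lev x; have := lev y; have := core_color_lt3 x y.
  by do !case: ifP => _; lia.
pose c x y := Ordinal (col_lt x y).
have csym : edge_coloring c.
  move=> x y; apply: val_inj; rewrite /= /extremal eq_sym maxnC core_colorC.
  by case: eqP => // ->.
case/(_ c csym) => [[x [y [z [_ _ _]]]]|/(double_star_nbr csym)].
  exact: extremal_no_rainbow.
case=> i [u [v [+ _ nu mv]]]; rewrite inE => /andP[vu /eqP/(congr1 val) /= uvi].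
by apply: (extremal_no_star mn vu uvi).
Qed.

(** * Gallai partitions *)

Section Gallai.
Variables (T K : finType) (c : T -> T -> K).
Hypothesis csym : forall x y, c x y = c y x.
Hypothesis no_rainbow : forall x y z, x != y -> y != z -> x != z ->
  [|| c x y == c y z, c y z == c x z | c x y == c x z].

Definition other_edge (U : {set T}) (r b : K) : rel T :=
  fun x y => [&& x \in U, y \in U, c x y != r & c x y != b].
Definition linked U r b := connect (other_edge U r b).

Lemma linked_sym (U : {set T}) r b : connect_sym (other_edge U r b).
Proof.
apply: sym_connect_sym => x y; rewrite /other_edge csym.
by case: (x \in U); case: (y \in U).
Qed.

Lemma linked_in (U : {set T}) r b x y : x \in U -> linked U r b x y -> y \in U.
Proof.
move=> xU xy; suff <- : (x \in U) = (y \in U) by [].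
by apply: closed_connect xy => z w /and4P[-> -> _ _].
Qed.

Lemma unlinked_color (U : {set T}) r b x y : x \in U -> y \in U -> ~~ linked U r b x y ->
  (c x y == r) || (c x y == b).
Proof.
move=> xU yU; apply: contraR; rewrite negb_or => /andP[nr nb].
by apply: connect1; apply/and4P.
Qed.

(** Consecutive vertices of a path in [other_edge] are joined by a third colour, while [z] sees both
    in [r] or [b]; without a rainbow triangle the latter two colours agree. *)
Lemma linked_homogeneous (U : {set T}) r b x y z : x \in U -> z \in U ->
  linked U r b x y -> ~~ linked U r b x z -> c z x = c z y.
Proof.
move=> xU zU /connectP[p]; elim: p x xU => [|w p IH] x xU /=; first by move=> _ ->.
move=> /andP[xw wp] yE xz; have wz : ~~ linked U r b w z.
  by apply: contra xz; apply: connect_trans; apply: connect1.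
have /and4P[_ wU xwr xwb] := xw.
rewrite -(IH _ wU wp yE wz).
have [->//|nxw] := eqVneq x w.
have nxz : x != z by apply: contraNneq xz => ->; apply: connect0.
have nwz : w != z by apply: contraNneq wz => ->; apply: connect0.
have not_rb t : t \in U -> ~~ linked U r b t z -> c x w != c t z.
  move=> tU tz; case/orP: (unlinked_color tU zU tz) => /eqP->; first exact: xwr.
  exact: xwb.
have := no_rainbow nxw nwz nxz; rewrite (negPf (not_rb x xU xz)) (negPf (not_rb w wU wz)).
by rewrite orbF /= => /eqP; rewrite ![c z _]csym.
Qed.

Lemma isolated_unlinked (U : {set T}) r b v y : y != v ->
  (forall z, z \in U -> z != v -> (c v z == r) || (c v z == b)) ->
  ~~ linked U r b v y.
Proof.
move=> yv h; apply/negP => vy; move: yv.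
suff : (v \in pred1 v) = (y \in pred1 v) by rewrite !inE eqxx => <-.
apply: closed_connect vy => z w /and4P[zU wU]; rewrite !inE.
have [->|zv] := eqVneq z v; have [->|wv] := eqVneq w v => //.
  by case/orP: (h w wU wv) => ->.
by rewrite csym; case/orP: (h z zU zv) => ->.
Qed.

(* The classes of [linked U r b] are the parts of a Gallai partition: they are
   homogeneous by [linked_homogeneous], and only r and b occur between them. *)
Lemma gallai (U : {set T}) : 1 < #|U| ->
  exists r b x y, [/\ x \in U, y \in U & ~~ linked U r b x y].
Proof.
have [s] := ubnP #|U|; elim: s U => // s IH U Us U1.
have /card_gt0P[v vU] : 0 < #|U| by lia.
pose W := U :\ v.
have UW : #|U| = #|W|.+1 by rewrite (cardsD1 v) vU.
have WU z : z \in W -> z \in U /\ z != v by rewrite !inE => /andP[].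
have UW' z : z \in U -> z != v -> z \in W by rewrite !inE => -> ->.
have isol r b : (forall z, z \in W -> (c v z == r) || (c v z == b)) ->
    exists r b x y, [/\ x \in U, y \in U & ~~ linked U r b x y].
  move=> h; have /card_gt0P[y /WU[yU yv]] : 0 < #|W| by lia.
  by exists r, b, v, y; split=> //; apply: isolated_unlinked => // z zU /(UW' _ zU)/h.
have [W1|W1] := leqP #|W| 1.
  have /cards1P[y Wy] : #|W| == 1 by lia.
  by apply: (isol (c v y) (c v y)) => z; rewrite Wy inE => /eqP->; rewrite eqxx.
have [|r [b [x [y [xW yW xy]]]]] := IH W _ W1; first by lia.
pose out z := (c v z != r) && (c v z != b).
(* A class of [W] with no third colour towards [v] remains a class in [U] and misses [v]. *)
have [/exists_inP[w wW /forallP hw]|] :=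
    boolP [exists w in W, [forall z, linked W r b w z ==> ~~ out z]].
  have [wU wv] := WU _ wW.
  exists r, b, w, v; split=> //; apply/negP=> wlv.
  suff : w \in [pred z | linked W r b w z] = (v \in [pred z | linked W r b w z]).
    rewrite !inE /linked connect0 => /esym/(linked_in wW); by rewrite !inE eqxx.
  apply: closed_connect wlv.
  apply: intro_closed; first exact: linked_sym.
  move=> z t /and4P[zU tU ztr ztb]; rewrite !inE => wz.
  have zW := linked_in wW wz.
  have tv : t != v.
    apply: contraTneq (implyP (hw z) wz) => tv.
    by rewrite negbK /out csym -tv ztr ztb.
  by apply: connect_trans wz _; apply: connect1; apply/and4P; split=> //; apply: UW'.
rewrite negb_exists => /forallP nout.
(* Now every class contains a vertex joined to [v] in a third colour. The rest shows that [v] sends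
   only two colours to [W], so that [isol] applies. *)
have hout w : w \in W -> exists z, [/\ z \in W, linked W r b w z & out z].
  move=> wW; have := nout w; rewrite wW /= negb_forall => /existsP[z].
  by rewrite negb_imply negbK => /andP[wz oz]; exists z; split=> //; apply: linked_in wz.
have apart z : exists t, t \in W /\ ~~ linked W r b z t.
  have [zx|] := boolP (linked W r b z x); last by exists x.
  exists y; split=> //; apply: contra xy; apply: connect_trans.
  by rewrite linked_sym.
have tri p q : p \in W -> q \in W -> ~~ linked W r b p q -> out q ->
    c v p = c v q \/ c v p = c p q.
  move=> pW qW pq /andP[qr qb]; have [_ pv] := WU _ pW; have [_ qv] := WU _ qW.
  rewrite eq_sym in pv; rewrite eq_sym in qv.
  have npq : p != q by apply: contraNneq pq => ->; apply: connect0.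
  case/or3P: (no_rainbow pv npq qv) => /eqP; [by right | | by left].
  by have /orP[/eqP-> e|/eqP-> e] := unlinked_color pW qW pq; move: qr qb; rewrite -e eqxx.
have unlk p q z : ~~ linked W r b p q -> linked W r b q z -> ~~ linked W r b p z.
  by move=> pq qz; apply: contra pq => pz; apply: connect_trans pz _; rewrite linked_sym.
have same p q : p \in W -> q \in W -> ~~ linked W r b p q -> out p -> out q -> c v p = c v q.
  move=> pW qW pq /andP[pr pb] oq; have [//|e] := tri p q pW qW pq oq.
  by have := unlinked_color pW qW pq; rewrite -e (negPf pr) (negPf pb).
have [u [uW _ ou]] := hout x xW.
(* Third-colour edges at [v] that end in the same class are compared through one that ends in
   another class. *)
have allg p : p \in W -> out p -> c v p = c v u.
  move=> pW op; have [pu|pu] := boolP (linked W r b p u); last exact: same.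
  have [t [tW pt]] := apart p; have [q [qW tq oq]] := hout t tW.
  have pq := unlk _ _ _ pt tq.
  rewrite (same p q) // (same u q) //.
  by apply: contra pq; apply: connect_trans.
have cross p t : p \in W -> t \in W -> ~~ out p -> ~~ linked W r b p t -> c p t = c v p.
  move=> pW tW op pt; have [q [qW tq oq]] := hout t tW.
  have pq := unlk _ _ _ pt tq.
  have <- : c p q = c p t.
    by apply/esym; apply: linked_homogeneous tq _ => //; rewrite /linked linked_sym.
  by have [e|//] := tri p q pW qW pq oq; move: op oq; rewrite /out e => /negP.
(* [r] and [b] cannot both occur at [v]. If [v] sees [p] in [r] and [q] in [b], then by [cross] the
   edge between [p] and [q] gets both colours if their classes differ; if they share a class, they
   send different colours to a vertex of another class. *)
have [/exists_inP[p pW /eqP pr]|] := boolP [exists p in W, c v p == r]; last first.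
  rewrite negb_exists => /forallP nr; apply: (isol (c v u) b) => z zW.
  have := nr z; rewrite zW /= => zr; have [->|zb] := eqVneq (c v z) b; first by rewrite orbT.
  by rewrite allg ?eqxx // /out zr zb.
apply: (isol (c v u) r) => q qW.
have [->|qr] := eqVneq (c v q) r; first by rewrite orbT.
have [qb|qb] := eqVneq (c v q) b; last by rewrite allg ?eqxx // /out qr qb.
have op : ~~ out p by rewrite /out pr eqxx.
have oq : ~~ out q by rewrite /out qb eqxx andbF.
have [pq|pq] := boolP (linked W r b p q); last first.
  move: qr; rewrite -pr -(cross p q) // [c p q]csym (cross q p) ?eqxx //.
  by rewrite /linked linked_sym.
have [t [tW pt]] := apart p.
have qt : ~~ linked W r b q t by apply: contra pt; apply: connect_trans.
move: qr; rewrite -pr -(cross p t) // -(cross q t) // [c q t]csym [c p t]csym.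
by rewrite (linked_homogeneous pW tW pq pt) eqxx.
Qed.
End Gallai.

(** * Colourings without a monochromatic double star *)

Lemma subset_of_card (T : finType) (A : {set T}) k : k <= #|A| ->
  exists2 B : {set T}, B \subset A & #|B| = k.
Proof.
move=> kA; exists [set x in take k (enum A)].
  by apply/subsetP=> x; rewrite inE => /mem_take; rewrite mem_enum.
by rewrite cardsE (card_uniqP _) ?size_takel -?cardE // take_uniq ?enum_uniq.
Qed.

(** Hall's condition for two sets: [B] uses up [S' :\: S] before it takes anything from the
    intersection. *)
Lemma disjoint_subsets (T : finType) (S S' : {set T}) n m :
  n <= #|S| -> m <= #|S'| -> n + m <= #|S :|: S'| ->
  exists A B : {set T}, [/\ A \subset S, B \subset S', [disjoint A & B], #|A| = n & #|B| = m].
Proof.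
move=> nS mS' nm; suff [B [sB cB nB]] :
    exists B : {set T}, [/\ B \subset S', #|B| = m & n <= #|S :\: B|].
  have [A sA cA] := subset_of_card nB; exists A, B; split=> //.
    by apply: subset_trans sA (subsetDl _ _).
  by apply/pred0P=> x /=; apply/negP=> /andP[/(subsetP sA)]; rewrite inE => /andP[/negP].
have := cardsID S S'; have := cardsU S S'; have := cardsID S' S; rewrite [S' :&: S]setIC.
move=> eS eU eS'; have [h|h] := leqP m #|S' :\: S|.
  have [B sB cB] := subset_of_card h; exists B; split=> //.
    by apply: subset_trans sB (subsetDl _ _).
  rewrite (_ : S :\: B = S) //; apply/setDidPl; rewrite disjoint_sym disjoints_subset.
  by apply: subset_trans sB _; rewrite setDE subsetIr.
have hI : m - #|S' :\: S| <= #|S :&: S'| by lia.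
have [B sB cB] := subset_of_card hI; exists (S' :\: S :|: B).
have [BS BS'] : B \subset S /\ B \subset S' by apply/andP; rewrite -subsetI.
have dB : (S' :\: S) :&: B = set0.
  by apply/eqP; rewrite setIC setI_eq0 disjoints_subset setCD subsetU // BS orbT.
split; first by rewrite subUset subsetDl.
  by rewrite cardsU dB cards0; lia.
have -> : S :\: (S' :\: S :|: B) = S :\: B.
  by apply/setP=> x; rewrite !inE; case: (x \in S); rewrite ?andbF.
by have := cardsID B S; rewrite (setIidPr BS); lia.
Qed.

Lemma nbr_double_star (N k n m : nat) (c : 'I_N -> 'I_N -> 'I_k) i u v :
  edge_coloring c -> v \in nbr c i u -> n < #|nbr c i u| -> m < #|nbr c i v| ->
  n + m + 2 <= #|nbr c i u :|: nbr c i v| -> has_mono_double_star c n m.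
Proof.
move=> csym; rewrite inE => /andP[vu /eqP cuv] nu mv uvnm.
have vNu : v \in nbr c i u by rewrite inE vu cuv eqxx.
have uNv : u \in nbr c i v by rewrite inE eq_sym vu csym cuv eqxx.
pose S := nbr c i u :\ v; pose S' := nbr c i v :\ u.
have cS : #|S|.+1 = #|nbr c i u| by rewrite (cardsD1 v (nbr c i u)) vNu.
have cS' : #|S'|.+1 = #|nbr c i v| by rewrite (cardsD1 u (nbr c i v)) uNv.
have cU : n + m <= #|S :|: S'|.
  have /subset_leq_card : nbr c i u :|: nbr c i v \subset [set u; v] :|: (S :|: S').
    by apply/subsetP=> x; rewrite !inE; case: (x == v); case: (x == u); rewrite ?orbT //= orbF.
  have := cardsU [set u; v] (S :|: S'); rewrite cards2; case: (u != v); lia.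
have [A [B [sA sB dAB cA cB]]] : exists A B : {set 'I_N},
    [/\ A \subset S, B \subset S', [disjoint A & B], #|A| = n & #|B| = m].
  by apply: disjoint_subsets cU; rewrite -ltnS ?cS ?cS'.
have nA x : x \in A -> [&& x != v, x != u & c u x == i].
  by move/(subsetP sA); rewrite !inE.
have nB x : x \in B -> [&& x != u, x != v & c v x == i].
  by move/(subsetP sB); rewrite !inE.
exists i, u, v, A, B; split=> //; first by rewrite eq_sym.
  by split=> //; apply/negP; try (by move/nA; rewrite eqxx ?andbF);
    move/nB; rewrite eqxx ?andbF.
by split=> // x; [move/nA | move/nB] => /and3P[_ _ /eqP].
Qed.

(** Double counting: pairs in [e] are counted from [R], pairs in [f] from [B]. *)
Lemma card_bipartite_cover (T : finType) (R B : {set T}) (e f : rel T) s t :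
  (forall v w, v \in R -> w \in B -> e v w || f v w) ->
  (forall v, v \in R -> #|[set w in B | e v w]| <= s) ->
  (forall w, w \in B -> #|[set v in R | f v w]| <= t) ->
  #|R| * #|B| <= #|R| * s + #|B| * t.
Proof.
move=> ef es ft.
have cardE (S : {set T}) (p : pred T) : #|[set x in S | p x]| = \sum_(x in S) p x.
  rewrite -sum1_card; under eq_bigl do rewrite inE.
  by rewrite big_mkcondr; apply: eq_bigr => x _; case: (p x).
have -> : #|R| * #|B| = \sum_(v in R) \sum_(w in B) 1 by rewrite sum1_card sum_nat_const.
have: \sum_(v in R) \sum_(w in B) 1 <=
      \sum_(v in R) (\sum_(w in B) e v w + \sum_(w in B) f v w).
  apply: leq_sum => v vR; rewrite -big_split /=; apply: leq_sum => w wB.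
  by have := ef v w vR wB; case: (e v w); case: (f v w).
move/leq_trans; apply; rewrite big_split /= leq_add //.
  by rewrite -sum_nat_const; apply: leq_sum => v vR; rewrite -cardE es.
by rewrite exchange_big /= -sum_nat_const; apply: leq_sum => w wB; rewrite -cardE ft.
Qed.

Section NoDoubleStar.
Variables (T K : finType) (c : T -> T -> K) (n m : nat).
Hypothesis csym : forall x y, c x y = c y x.
(** The contrapositive of [nbr_double_star], over arbitrary finite types. *)
Hypothesis no_star : forall i u v, v \in nbr c i u -> n < #|nbr c i u| ->
  m < #|nbr c i v| -> #|nbr c i u :|: nbr c i v| <= n + m + 1.

Lemma nbrC i u v : (u \in nbr c i v) = (v \in nbr c i u).
Proof. by rewrite !inE eq_sym csym. Qed.

Lemma nbr_bound i u v : v \in nbr c i u -> m < #|nbr c i v| -> #|nbr c i u| <= n + m.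
Proof.
move=> uv mv; rewrite leqNgt; apply/negP=> nu.
have := no_star uv _ mv.
have : u |: nbr c i u \subset nbr c i u :|: nbr c i v.
  by rewrite subUset subsetUl sub1set inE nbrC uv orbT.
by move/subset_leq_card; rewrite cardsU1 inE eqxx /=; lia.
Qed.

(** Otherwise a vertex of [Y] and one of [X] are centres whose neighbourhoods contain the disjoint
    sets [X] and [Y]. *)
Lemma complete_bipartite_bound i (X Y : {set T}) :
  (forall x y, x \in X -> y \in Y -> y \in nbr c i x) -> m < #|Y| -> #|X| <= n.
Proof.
move=> XY mY; rewrite leqNgt; apply/negP=> nX.
have /card_gt0P[x xX] : 0 < #|X| by lia.
have /card_gt0P[y yY] : 0 < #|Y| by lia.
have sX : X \subset nbr c i y by apply/subsetP=> z zX; rewrite nbrC XY.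
have sY : Y \subset nbr c i x by apply/subsetP=> z zY; rewrite XY.
have XY0 : X :&: Y = set0.
  by apply/setP=> z; rewrite !inE; apply/negP=> /andP[zX /(XY z z zX)]; rewrite !inE eqxx.
have := no_star (u := y) (v := x) (i := i).
have nx := leq_trans nX (subset_leq_card sX).
have my := leq_trans mY (subset_leq_card sY).
rewrite nbrC XY // => /(_ isT nx my).
have := subset_leq_card (setUSS sX sY); rewrite cardsU XY0 cards0; lia.
Qed.

(** * Degree bounds along a Gallai partition *)

Section Partition.
Variables (A : {set T}) (P : T -> {set T}).

(* Gallai partition of A into parts of size at most n; P x is the part of x. *)
Definition gallai_partition (r b : K) :=
  [/\ forall x, x \in A -> x \in P x /\ P x \subset A,
      forall x y, x \in A -> y \in P x -> P y = P x,
      forall x y, x \in A -> y \in A -> y \notin P x -> (c x y == r) || (c x y == b),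
      forall x y z, x \in A -> y \in A -> y \notin P x -> z \in P x -> c y z = c y x
    & forall x, x \in A -> #|P x| <= n].

Lemma gallai_partitionC r b : gallai_partition r b -> gallai_partition b r.
Proof. by case=> *; split=> // x y xA yA xy; rewrite orbC; auto. Qed.

Definition cross i x := [set y in A | (y \notin P x) && (c x y == i)].

Section Cross.
Variables r b : K.
Hypothesis gp : gallai_partition r b.

Lemma cross_nbr i x : x \in A -> cross i x \subset nbr c i x :&: A.
Proof.
case: gp => + _ _ _ _ => /(_ x) h xA; have [xP _] := h xA.
apply/subsetP=> y; rewrite !inE => /and3P[yA yP ->]; rewrite yA !andbT.
by apply: contraNneq yP => ->.
Qed.

Lemma cross_part i x v z : x \in A -> v \in cross i x -> z \in P x -> z \in nbr c i v.
Proof.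
case: gp => _ _ _ h _ xA; rewrite !inE => /and3P[vA vP /eqP cxv] zP.
rewrite (h x v z) // csym cxv eqxx andbT; by apply: contraNneq vP => <-.
Qed.

Lemma card_cross x : x \in A -> #|A| <= #|P x| + #|cross r x| + #|cross b x|.
Proof.
case: gp => h _ col _ _ xA.
have : A \subset P x :|: cross r x :|: cross b x.
  apply/subsetP=> y yA; rewrite !inE yA /=; have [//|yP] := boolP (y \in P x).
  by rewrite /= (col x y).
move/subset_leq_card; have := cardsU (P x :|: cross r x) (cross b x).
have := cardsU (P x) (cross r x); lia.
Qed.

Lemma part_separated u v z : u \in A -> v \in A -> v \notin P u -> z \in P v -> z \notin P u.
Proof.
case: gp => self eqP' _ _ _ uA vA vPu zv; apply: contraNN vPu => zu.
have [vPv _] := self v vA; have [_ /subsetP sP] := self u uA.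
have zP : z \in P z by case: (self z (sP z zu)).
by rewrite -(eqP' u z uA zu) (eqP' v z vA zv).
Qed.

Lemma notin_partC u v : u \in A -> v \in A -> v \notin P u -> u \notin P v.
Proof.
case: gp => self eqP' _ _ _ uA vA; apply: contraNN => uv.
by have [vPv _] := self v vA; rewrite (eqP' v u vA uv).
Qed.

Lemma part_le x : x \in A -> #|P x| <= n. Proof. by case: gp => _ _ _ _; apply. Qed.

Lemma cross_le i x : x \in A -> #|cross i x| <= #|nbr c i x|.
Proof.
move=> xA; apply: leq_trans (subset_leq_card (cross_nbr i xA)) _.
exact: subset_leq_card (subsetIl _ _).
Qed.

(** If [v] violates the bound, its [b]-neighbours in [A] have [b]-degree at most [m], hence more
    than [n + m] [r]-neighbours in other parts. By [nbr_bound] no two of them are joined in [r], so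
    they are disjoint from the [r]-neighbours of any one of them, and both sets do not fit into
    [A]. *)
Lemma inner_nbr_le v : 2 * n + 2 * m + 1 <= #|A| -> v \in A ->
  #|nbr c b v :&: A| <= n + m.
Proof.
move=> aA vA; rewrite leqNgt; apply/negP=> nv.
have nv' := leq_trans nv (subset_leq_card (subsetIl _ _)).
have big w : w \in nbr c b v :&: A -> #|A| <= #|cross r w| + m + n.
  rewrite inE => /andP[vw wA].
  have wm : #|nbr c b w| <= m.
    by rewrite leqNgt; apply/negP=> /(nbr_bound vw); lia.
  by have := card_cross wA; have := part_le wA; have := cross_le b wA; lia.
have /card_gt0P[w wZ] : 0 < #|nbr c b v :&: A| by lia.
have wA : w \in A by move: wZ; rewrite inE => /andP[].
have dZ : cross r w :&: (nbr c b v :&: A) = set0.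
  apply/setP=> w'; rewrite in_set0; apply/negP; rewrite in_setI.
  move=> /andP[/(subsetP (cross_nbr r wA)) w'r w'Z].
  move: w'r; rewrite in_setI => /andP[w'r w'A].
  have := nbr_bound w'r; have := big _ w'Z; have := big _ wZ.
  by have := cross_le r wA; have := cross_le r w'A; lia.
have : cross r w :|: (nbr c b v :&: A) \subset A.
  by rewrite subUset subsetIr andbT; apply: subset_trans (cross_nbr r wA) (subsetIr _ _).
move/subset_leq_card; rewrite cardsU dZ cards0; have := big _ wZ; lia.
Qed.

(** A part with more than [m] vertices sends only [b] to the rest of [A], so this rest has at most
    [n] vertices. If all parts have at most [m] vertices, every vertex has more than [n + m]
    [b]-neighbours, against [nbr_bound]. *)
Lemma one_sparse_color : 2 * n + 1 <= #|A| -> n + 3 * m + 1 <= #|A| ->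
  (forall v, v \in A -> #|nbr c r v| <= m) -> False.
Proof.
move=> a1 a2 rm; have /card_gt0P[x0 x0A] : 0 < #|A| by lia.
have [/exists_inP[x xA mP]|] := boolP [exists x in A, m < #|P x|].
  have sP : P x \subset A by case: gp => /(_ x xA)[].
  have cr : cross r x = set0.
    apply/setP=> v; rewrite in_set0; apply/negP=> vx.
    have vA : v \in A by move: vx; rewrite inE => /andP[].
    have : P x \subset nbr c r v by apply/subsetP=> z; apply: cross_part.
    by move/subset_leq_card; have := rm _ vA; lia.
  have := @complete_bipartite_bound b (cross b x) (P x) _ mP.
  have := card_cross xA; rewrite cr cards0; have := part_le xA.
  by move=> ? ? h; have := h (fun v z vx zx => cross_part xA vx zx); lia.
rewrite negb_exists => /forallP Pm.
have big x : x \in A -> n + m + 1 <= #|cross b x|.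
  move=> xA; have := Pm x; rewrite xA -leqNgt; have := card_cross xA; have := rm _ xA.
  by have := cross_le r xA; lia.
have /card_gt0P[y yx] : 0 < #|cross b x0| by have := big _ x0A; lia.
have := subsetP (cross_nbr b x0A) _ yx; rewrite in_setI => /andP[xy yA].
have := nbr_bound xy; have := big _ x0A; have := big _ yA.
by have := cross_le b x0A; have := cross_le b yA; lia.
Qed.

(** Otherwise [v] and [x] are centres whose neighbourhoods cover [P x] and [cross r x], that is, all
    but at most [n] vertices of [A]. *)
Lemma cross_nbr_le x v : x \in A -> v \in cross r x -> #|cross b x| <= n ->
  m < #|P x| -> m < #|cross r x| -> 2 * n + m + 2 <= #|A| -> #|nbr c r v| <= n.
Proof.
move=> xA vx bn mP mr aA; rewrite leqNgt; apply/negP=> nv.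
have := subsetP (cross_nbr r xA) _ vx; rewrite in_setI => /andP[xv vA].
have := no_star _ nv (leq_trans mr (cross_le r xA)); rewrite nbrC => /(_ xv).
have : P x :|: cross r x \subset nbr c r v :|: nbr c r x.
  apply: setUSS; last by apply: subset_trans (cross_nbr r xA) (subsetIl _ _).
  by apply/subsetP=> z; apply: cross_part.
move/subset_leq_card; have := card_cross xA; rewrite cardsU.
have -> : P x :&: cross r x = set0.
  by apply/setP=> z; rewrite !inE; case: (z \in P x); rewrite ?andbF.
by rewrite cards0; lia.
Qed.

End Cross.

(** * Sets of at least (5n - 1)/2 vertices *)

Section DenseCore.
Variables r b : K.
Hypothesis gp : gallai_partition r b.
Hypotheses (nm : 6 * m + 7 <= n) (aA : 5 * n <= 2 * #|A| + 1).

Lemma large_part x : r != b -> x \in A -> n < 2 * #|P x| -> False.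
Proof.
move=> rb xA pn; have gp' := gallai_partitionC gp.
have mP : m < #|P x| by lia.
have Rn : #|cross r x| <= n.
  by apply: (complete_bipartite_bound _ mP) => v z vx zx; apply: (cross_part gp xA vx zx).
have Bn : #|cross b x| <= n.
  by apply: (complete_bipartite_bound _ mP) => v z vx zx; apply: (cross_part gp' xA vx zx).
have ple := part_le gp xA; have cc := card_cross gp xA.
(* [v] is joined in [i] to all of [P x] and has at most [n] neighbours in that colour. *)
have half i j (gij : gallai_partition i j) v : #|cross i x| <= n -> #|cross j x| <= n ->
    v \in cross i x -> #|[set w in cross j x | w \in nbr c i v]| <= n - #|P x|.
  move=> In Jn vx.
  have := cross_nbr_le gij xA vx Jn mP; have := card_cross gij xA.
  have sub : P x :|: [set w in cross j x | w \in nbr c i v] \subset nbr c i v.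
    rewrite subUset; apply/andP; split; apply/subsetP=> z; first exact: (cross_part gij xA vx).
    by rewrite inE => /andP[].
  move/subset_leq_card: sub; rewrite cardsU.
  have -> : P x :&: [set w in cross j x | w \in nbr c i v] = set0.
    by apply/setP=> z; rewrite !inE; case: (z \in P x); rewrite ?andbF.
  by rewrite cards0; lia.
have : #|cross r x| * #|cross b x| <=
    #|cross r x| * (n - #|P x|) + #|cross b x| * (n - #|P x|).
  apply: (card_bipartite_cover (e := fun v w => w \in nbr c r v)
                               (f := fun v w => v \in nbr c b w)).
  - move=> v w vR wB.
    have [vA vP cv] : [/\ v \in A, v \notin P x & c x v = r].
      by move: vR; rewrite inE => /and3P[? ? /eqP].
    have [wA wP cw] : [/\ w \in A, w \notin P x & c x w = b].
      by move: wB; rewrite inE => /and3P[? ? /eqP].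
    case: gp => self _ col hom _.
    have wv : w \notin P v.
      apply: contraNN rb => wPv.
      by rewrite -cv -cw (hom v x w) // (notin_partC gp).
    have nwv : w != v by apply: contraNneq wv => ->; case: (self v vA).
    by rewrite !inE [v == w]eq_sym nwv (csym w) /=; apply: col.
  - by move=> v; apply: half.
  - by move=> w; apply: half.
move: Rn Bn pn ple cc aA nm.
move: #|cross r x| #|cross b x| #|P x| #|A| => R B p a.
move=> Rn Bn pn pl cc a5 nm6 h.
have [R' Re] : exists R', n = R + R' by exists (n - R); lia.
have [B' Be] : exists B', n = B + B' by exists (n - B); lia.
have [q qe] : exists q, n = p + q by exists (n - p); lia.
have nq : n - p = q by lia.
(* The count gives [(R + B) * p <= n * n - (n - R) * (n - B)]. *)
have sp : (R + B) * p <= n * n by rewrite nq in h; nia.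
have : (a - p) * p <= n * n by apply: leq_trans sp; rewrite leq_mul2r; lia.
(* [(a - p) * p] is concave in [p] and exceeds [n * n] at both ends of the range from [(n + 1) / 2]
   to [n], as [a] is at least [(5 * n - 1) / 2]. *)
by nia.
Qed.

Lemma excess_cross u : (forall x, x \in A -> 2 * #|P x| <= n) ->
  u \in A -> n < #|cross r u| -> False.
Proof.
move=> small uA nu; have gp' := gallai_partitionC gp.
have aA' : 2 * n + 2 * m + 1 <= #|A| by lia.
have /card_gt0P[v vu] : 0 < #|cross r u| by lia.
have := subsetP (cross_nbr gp r uA) _ vu; rewrite in_setI => /andP[uv vA].
have bv : #|cross b v| <= n + m.
  exact: leq_trans (subset_leq_card (cross_nbr gp b vA)) (inner_nbr_le gp aA' vA).
have mv : m < #|nbr c r v|.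
  by have := card_cross gp vA; have := small v vA; have := cross_le gp r vA; lia.
have := no_star uv (leq_trans nu (cross_le gp r uA)) mv.
have XX : cross r u :|: cross r v \subset nbr c r u :|: nbr c r v.
  by apply: setUSS; apply: subset_trans (cross_nbr gp r _) (subsetIl _ _).
have vPu : v \notin P u by move: vu; rewrite inE => /and3P[].
have cuv : c u v = r by move: uv; rewrite inE => /andP[_ /eqP].
(* The part of [v] lies in [cross r u], since [u] sends one colour to it. Hence [A] has at most
   [(n + m + 1) + (n + m)] vertices. *)
have : A \subset (cross r u :|: cross r v) :|: cross b v.
  case: (gp) => self _ col hom _.
  apply/subsetP=> z zA; have [zP|zP] := boolP (z \in P v).
    suff : z \in cross r u by rewrite !in_setU => ->.
    by rewrite inE zA (part_separated gp uA vA) // (hom v u z) ?cuv ?eqxx // (notin_partC gp).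
  have := col v z vA zA zP; rewrite 2!in_setU !(inE, zA, zP) /= => /orP[] ->; rewrite ?orbT //.
move/subset_leq_card; have := subset_leq_card XX.
by have := cardsU (cross r u :|: cross r v) (cross b v); lia.
Qed.

End DenseCore.

Lemma card_equal_parts r b q : gallai_partition r b ->
  (forall x, x \in A -> #|P x| = q) -> #|A| = #|P @: A| * q.
Proof.
case=> self eqP' _ _ _ Pq; apply: card_uniform_partition.
  by move=> _ /imsetP[x xA ->]; apply: Pq.
apply/and3P; split.
- apply/eqP/setP=> z; apply/bigcupP/idP => [[_ /imsetP[x xA ->]]|zA].
    by case: (self x xA) => _ /subsetP; apply.
  by exists (P z); [apply: imset_f | case: (self z zA)].
- apply/trivIsetP=> _ _ /imsetP[x xA ->] /imsetP[y yA ->]; apply: contraNT.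
  case/pred0Pn=> z /= /andP[zx zy].
  by rewrite -(eqP' x z xA zx) (eqP' y z yA zy).
- by apply/imsetP=> -[x xA] e; have [] := self x xA; rewrite -e inE.
Qed.

Lemma dense_core r b : gallai_partition r b -> r != b -> 6 * m + 7 <= n ->
  5 * n + 2 <= 2 * #|A| + 3 * odd n -> False.
Proof.
move=> gp rb nm aA; have aA1 : 5 * n <= 2 * #|A| + 1 by lia.
have small x : x \in A -> 2 * #|P x| <= n.
  by move=> xA; rewrite leqNgt; apply/negP; apply: (large_part gp nm aA1 rb xA).
have gp' := gallai_partitionC gp.
have rn u : u \in A -> #|cross r u| <= n.
  by move=> uA; rewrite leqNgt; apply/negP; apply: (excess_cross gp nm aA1 small uA).
have bn u : u \in A -> #|cross b u| <= n.
  by move=> uA; rewrite leqNgt; apply/negP; apply: (excess_cross gp' nm aA1 small uA).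
have h x : x \in A -> #|A| <= #|P x| + 2 * n /\ 2 * #|P x| <= n.
  move=> xA; have := card_cross gp xA; have := rn x xA.
  by have := bn x xA; have := small x xA; lia.
have /card_gt0P[x0 x0A] : 0 < #|A| by lia.
(* The bounds leave only odd [n] with [#|A| = 2 * n + n %/ 2], which forces equality for every
   part. *)
have Pq x : x \in A -> #|P x| = n %/ 2 by move=> /h; lia.
have := card_equal_parts gp Pq; have := h _ x0A; rewrite (Pq _ x0A).
move: #|A| #|P @: A| aA => a t aA.
have [q qe] : exists q, q = n %/ 2 by exists (n %/ 2).
rewrite -qe => hh e; have q3 : 3 <= q by lia.
(* No multiple of [q] equals [5 * q + 2] when [q] is at least 3. *)
have {aA hh} e : t * q = 5 * q + 2 by lia.
have [t5|t5] := leqP t 5.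
  by have : t * q <= 5 * q by [rewrite leq_mul2r t5 orbT]; lia.
by have : 6 * q <= t * q by [rewrite leq_mul2r t5 orbT]; lia.
Qed.
End Partition.

(** * Minimal homogeneous sets *)

Definition homogeneous (A : {set T}) :=
  [forall x in ~: A, forall y in A, forall z in A, c x y == c x z].

Lemma homogeneousP (A : {set T}) : reflect
  (forall x y z, x \notin A -> y \in A -> z \in A -> c x y = c x z) (homogeneous A).
Proof.
apply: (iffP forall_inP) => [h x y z xA yA zA | h x xA].
  have xA' : x \in ~: A by rewrite inE.
  by apply/eqP; have /forall_inP/(_ y yA)/forall_inP/(_ z zA) := h x xA'.
apply/forall_inP=> y yA; apply/forall_inP=> z zA; apply/eqP/h => //.
by rewrite inE in xA.
Qed.

Lemma minimal_homogeneous : n < #|T| -> exists A : {set T},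
  [/\ homogeneous A, n < #|A|
    & forall B, homogeneous B -> #|B| < #|A| -> #|B| <= n].
Proof.
move=> nT.
have h0 : homogeneous [set: T] && (n < #|[set: T]|).
  by rewrite cardsT nT andbT; apply/homogeneousP=> x y z; rewrite inE.
pose p B := homogeneous B && (n < #|B|).
case: (@arg_minnP _ [set: T] p (fun B => #|B|) h0) => A /andP[hA nA] minA.
exists A; split=> // B hB; rewrite ltnNge; apply: contraNleq => nB.
by apply: minA; rewrite /p hB.
Qed.

Hypothesis no_rainbow : forall x y z, x != y -> y != z -> x != z ->
  [|| c x y == c y z, c y z == c x z | c x y == c x z].

(** Each part is homogeneous: towards vertices outside [A] because [A] is, towards the rest of [A]
    by [linked_homogeneous]. It is a proper subset of [A], so minimality bounds it by [n]. *)
Lemma gallai_partition_minimal (A : {set T}) : homogeneous A -> 1 < #|A| ->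
  (forall B, homogeneous B -> #|B| < #|A| -> #|B| <= n) ->
  1 < #|K| -> exists P r b, gallai_partition A P r b /\ r != b.
Proof.
move=> /homogeneousP hA A1 minA K1.
have [r [b [x0 [y0 [x0A y0A xy0]]]]] := gallai csym no_rainbow A1.
pose P x := [set y | linked c A r b x y].
have PA x : x \in A -> P x \subset A.
  by move=> xA; apply/subsetP=> y; rewrite inE; apply: linked_in.
have Peq x y : y \in P x -> P y = P x.
  rewrite inE => xy; apply/setP=> z; rewrite !inE.
  apply/idP/idP; first exact: connect_trans xy.
  by move=> xz; apply: connect_trans xz; rewrite /linked linked_sym.
have hom x y z : x \in A -> y \in A -> y \notin P x -> z \in P x -> c y z = c y x.
  rewrite !inE => xA yA xy xz; apply/esym.
  exact: (linked_homogeneous csym no_rainbow xA yA xz xy).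
have Pn x : x \in A -> #|P x| <= n.
  move=> xA; apply: minA; last first.
    apply: proper_card; rewrite properEneq PA // andbT; apply: contraNneq xy0 => PxA.
    have xx0 : x0 \in P x by rewrite PxA.
    have : y0 \in P x by rewrite PxA.
    move: xx0; rewrite !inE => xx0; apply: connect_trans.
    by rewrite /linked linked_sym.
  apply/homogeneousP=> z y y' zP yP y'P.
  have [zA|zA] := boolP (z \in A); last first.
    by apply: hA => //; apply: (subsetP (PA x xA)).
  by rewrite (hom x z y) // (hom x z y').
have gp r' b' : (forall i, (i == r) || (i == b) -> (i == r') || (i == b')) ->
    gallai_partition A P r' b'.
  move=> sub; split=> //.
  - by move=> x xA; rewrite inE /linked connect0; split=> //; apply: PA.
  - by move=> x y _; apply: Peq.
  - by move=> x y xA yA; rewrite inE => /(unlinked_color xA yA)/sub.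
have [rb|rb] := eqVneq r b; last by exists P, r, b; split=> //; apply: gp.
(* If the two colours coincide, any other colour serves as the second one. *)
have /card_gt0P[b'] : 0 < #|predC1 r| by rewrite cardC1; lia.
rewrite inE => br; exists P, r, b'; split; last by rewrite eq_sym.
by apply: gp => i; rewrite -rb orbb => ->.
Qed.

Lemma sum_card_nbr v : (\sum_i #|nbr c i v|).+1 = #|T|.
Proof.
rewrite -cardsT (cardsD1 v) inE -sum1_card (partition_big (c v) predT) //=.
congr _.+1; apply: eq_bigr => i _; rewrite -sum1_card; apply: eq_bigl => x.
by rewrite !inE andbT.
Qed.

(** * Colours leaving a homogeneous set *)

Definition outer_colors (A : {set T}) :=
  [set i | [exists x in ~: A, [exists y in A, c x y == i]]].

Section Outer.
Variable A : {set T}.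
Hypotheses (hA : homogeneous A) (nA : n < #|A|).

Lemma outer_colorP i : i \in outer_colors A ->
  exists2 x, x \notin A & A \subset nbr c i x.
Proof.
rewrite inE => /exists_inP[x xA /exists_inP[y yA /eqP xy]].
rewrite inE in xA; exists x => //; apply/subsetP=> z zA; rewrite inE.
rewrite -xy (homogeneousP _ hA x z y) // eqxx andbT.
by apply: contraNneq xA => <-.
Qed.

(** The outside vertices that send colour [i] to [A] form a complete bipartite graph with [A], which
    has more than [n] vertices, so there are at most [m] of them. *)
Lemma card_outer : #|T| <= #|A| + #|outer_colors A| * m.
Proof.
have /card_gt0P[a aA] : 0 < #|A| by lia.
rewrite -(cardsC A) leq_add2l -sum1_card.
rewrite (partition_big (c a) (mem (outer_colors A))) /=; last first.
  move=> x xA; rewrite inE; apply/exists_inP; exists x => //.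
  by apply/exists_inP; exists a => //; rewrite csym.
rewrite -sum_nat_const; apply: leq_sum => i _.
have -> : \sum_(x in ~: A | c a x == i) 1 = #|[set x in ~: A | c a x == i]|.
  by rewrite -sum1_card; apply: eq_bigl => x; rewrite !inE.
rewrite leqNgt; apply/negP=> /(@complete_bipartite_bound i A) h.
suff : #|A| <= n by lia.
apply: h => x y xA; rewrite !inE => /andP[yA /eqP <-].
rewrite csym (homogeneousP _ hA y x a) // csym eqxx andbT.
by apply: contraNneq yA => ->.
Qed.

Lemma outer_nbr_le i v : n + m < #|A| -> i \in outer_colors A -> v \in A -> #|nbr c i v| <= m.
Proof.
move=> nmA /outer_colorP[x xA sA] vA; rewrite leqNgt; apply/negP=> /(nbr_bound _) h.
by have := h x (subsetP sA v vA); have := subset_leq_card sA; lia.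
Qed.

Lemma inner_nbr i v : i \notin outer_colors A -> v \in A -> nbr c i v \subset A.
Proof.
move=> iA vA; apply/subsetP=> y; rewrite inE => /andP[_ vy]; apply: contraNT iA => yA.
rewrite inE; apply/exists_inP; exists y; first by rewrite inE.
by apply/exists_inP; exists v; rewrite // csym.
Qed.

End Outer.

(** The last numerical hypothesis is [core_size n + m * (#|K| - 3) < #|T|], cleared of halves. *)
Lemma large_coloring_absurd : 2 < #|K| -> 6 * m + 7 <= n ->
  5 * n + 2 + 2 * (m * (#|K| - 3)) <= 2 * #|T| + 3 * odd n -> False.
Proof.
move=> K3 nm Tge.
have [A [hA nA minA]] : exists A : {set T},
    [/\ homogeneous A, n < #|A|
      & forall B, homogeneous B -> #|B| < #|A| -> #|B| <= n].
  by apply: minimal_homogeneous; lia.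
have [||P [r [b [gp rb]]]] := gallai_partition_minimal hA _ minA; [by lia..|].
have gp' := gallai_partitionC gp.
have [k kE] : exists k, #|K| = k + 3 by exists (#|K| - 3); lia.
have Tle := card_outer hA nA; set D := outer_colors A in Tle *.
rewrite kE addnK in Tge.
have bound d : #|D| <= d -> #|T| <= #|A| + d * m.
  by move=> Dd; apply: leq_trans Tle _; rewrite leq_add2l leq_mul2r Dd orbT.
have Tle3 : #|T| <= #|A| + (k + 3) * m by apply: bound; rewrite -kE max_card.
have Dr i v : i \in D -> v \in A -> #|nbr c i v| <= m.
  by apply: outer_nbr_le; nia.
(* Each colour known to stay inside [A] improves the lower bound on [#|A|] by [m]. *)
have Kc (S : {set K}) : D \subset ~: S -> #|D| <= k + 3 - #|S|.
  by move/subset_leq_card; have := cardsC S; rewrite kE; lia.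
have /card_gt0P[x0 x0A] : 0 < #|A| by lia.
have [rD|rD] := boolP (r \in D); have [bD|bD] := boolP (b \in D).
- have := card_cross gp x0A; have := part_le gp x0A.
  have := cross_le gp r x0A; have := cross_le gp b x0A.
  by have := Dr r x0 rD x0A; have := Dr b x0 bD x0A; nia.
- have Tle2 : #|T| <= #|A| + (k + 2) * m.
    by apply: bound; have := Kc [set b]; rewrite cards1 subsetC sub1set in_setC bD => /(_ isT); lia.
  by apply: (one_sparse_color gp) => [||v]; [nia|nia|apply: Dr].
- have Tle2 : #|T| <= #|A| + (k + 2) * m.
    by apply: bound; have := Kc [set r]; rewrite cards1 subsetC sub1set in_setC rD => /(_ isT); lia.
  by apply: (one_sparse_color gp') => [||v]; [nia|nia|apply: Dr].
have [/forallP all|] := boolP [forall i, (i \notin [set r; b]) ==> (i \in D)].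
  have Tle1 : #|T| <= #|A| + (k + 1) * m.
    apply: bound; have := Kc [set r; b]; rewrite cards2 rb subsetC.
    by rewrite subUset !sub1set !in_setC rD bD => /(_ isT); lia.
  have aA : 2 * n + 2 * m + 1 <= #|A| by nia.
  have inner i : i \notin D -> #|nbr c i x0 :&: A| <= n + m -> #|nbr c i x0| <= n + m.
    by move=> iD; rewrite (setIidPl (inner_nbr iD x0A)).
  have rn := inner r rD (inner_nbr_le gp' aA x0A).
  have bn := inner b bD (inner_nbr_le gp aA x0A).
  (* At [x0] the colours [r] and [b] have degree at most [n + m], all others at most [m]. The sum
     would force [n <= 6 * m + 3]. *)
  have : \sum_i #|nbr c i x0| <= \sum_i (m + (i == r) * n + (i == b) * n).
    apply: leq_sum => i _; have := all i; rewrite in_set2.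
    have [->|ir] := eqVneq i r; first by move=> _; lia.
    have [->|ib] := eqVneq i b; first by move=> _; lia.
    by move=> /= iD; have := Dr i x0 iD x0A; lia.
  have sum1 j : \sum_(i : K) (i == j) * n = n.
    by rewrite (bigD1 j) //= eqxx big1 => [|i /negPf->]; lia.
  by rewrite !big_split /= !sum1 sum_nat_const kE; have := sum_card_nbr x0; nia.
(* The three colours [r], [b] and [j] stay inside [A], so at most [k] colours leave it and [#|A|]
   exceeds [core_size n]. *)
rewrite negb_forall => /existsP[j]; rewrite negb_imply => /andP[jrb jD].
apply: (dense_core gp rb nm).
have : #|T| <= #|A| + k * m.
  apply: bound; have := Kc (j |: [set r; b]); rewrite cardsU1 cards2 rb jrb subsetC.
  by rewrite !subUset !sub1set !in_setC rD bD jD => /(_ isT); lia.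
by nia.
Qed.

End NoDoubleStar.

Theorem theorem5 (n m k : nat) :
  1 <= m -> 3 <= k -> 6 * m + 7 <= n ->
  is_gr_K3_double_star k n m
    (if ~~ odd n then 5 * (n %/ 2) + m * (k - 3) + 1
     else 5 * ((n - 1) %/ 2) + m * (k - 3) + 2).
Proof.
move=> m1 k3 nm.
(* In both parities the value is one more than the order of the extremal colouring. *)
have -> : (if ~~ odd n then 5 * (n %/ 2) + m * (k - 3) + 1
     else 5 * ((n - 1) %/ 2) + m * (k - 3) + 2) = core_size n + m * (k - 3) + 1.
  by rewrite /core_size; case: ifP; lia.
split=> [c csym|N Ng]; last by apply: GR_prop_lower; lia.
have [/existsP[x /existsP[y /existsP[z /and5P[xy yz xz e1 /andP[e2 e3]]]]]|rainbow] :=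
  boolP [exists x, exists y, exists z, [&& x != y, y != z, x != z,
         c x y != c y z, c y z != c x z & c x y != c x z]].
  by left; exists x, y, z.
have [/existsP[i /existsP[u /existsP[v /and4P[uv nu mv nmuv]]]]|star] :=
  boolP [exists i, exists u, exists v, [&& v \in nbr c i u, n < #|nbr c i u|,
         m < #|nbr c i v| & n + m + 2 <= #|nbr c i u :|: nbr c i v|]].
  by right; apply: nbr_double_star nmuv.
exfalso; apply: (@large_coloring_absurd _ _ c n m csym); rewrite ?card_ord //; last first.
- by rewrite /core_size; move: (m * (k - 3)) => d; lia.
- move=> x y z xy yz xz; apply: contraNT rainbow; rewrite !negb_or => /and3P[e1 e2 e3].
  apply/existsP; exists x; apply/existsP; exists y; apply/existsP; exists z.
  by apply/and5P; split=> //; apply/andP.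
move=> i u v uv nu mv; rewrite leqNgt; apply: contraNN star => nmuv.
apply/existsP; exists i; apply/existsP; exists u; apply/existsP; exists v.
by apply/and4P; split=> //; rewrite addn2 -addn1.
Qed.
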